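(* Let $f_i(x)=\frac12x^TQ_ix-p_i^Tx+r_i$ for $i=1,\dots,N$, and consider the D-ASG iterates $x^{(k+1)}=\mathcal{W}y^{(k)}-\alpha\left[\nabla F(y^{(k)})+w^{(k+1)}\right]$, $y^{(k)}=(1+\beta)x^{(k)}-\beta x^{(k-1)}$, with $\alpha>0$, $\beta\ge0$ and additive i.i.d. noise. Let $\mu_1,\dots,\mu_{Nd}$ be the eigenvalues of $\mathcal W-\alpha Q$, and assume that the matrix $A_{\mathrm{dasg},Q}=\begin{bmatrix}(1+\beta)(\mathcal W-\alpha Q)&-\beta(\mathcal W-\alpha Q)\\ {I}_{Nd}&0_{Nd}\end{bmatrix}$ has spectral radius less than $1$. Then $$\lim_{k\to\infty}\mathrm{Var}\left(x^{(k)}-x^\infty\right)=\frac{\sigma^2}{d}\sum_{i=1}^{Nd}\frac{\alpha^2(1+\beta\mu_i)}{(1-\mu_i)(1-\beta\mu_i)\left(2+2\beta-(1-\mu_i)(1+2\beta)\right)},$$ and hence $J_\infty(\alpha):=\frac{1}{\sigma^2N}\limsup_{k\to\infty}\mathrm{Var}(x^{(k)})$ is given by $$J_\infty(\alpha)=\frac{1}{Nd}\sum_{i=1}^{Nd}\frac{\alpha^2(1+\beta\mu_i)}{(1-\mu_i)(1-\beta\mu_i)\left(2+2\beta-(1-\mu_i)(1+2\beta)\right)}.$$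
   Context: Each $Q_i$ is a symmetric $d\times d$ matrix with $\mu I_d\preceq Q_i\preceq LI_d$ ($0<\mu\le L$), $p_i\in\mathbb{R}^d$, $r_i\in\mathbb{R}$. $F(x_1,\dots,x_N)=\sum_{i=1}^Nf_i(x_i)=\frac12x^TQx-p^Tx+r$ on $\mathbb{R}^{Nd}$, with $Q=\mathrm{diag}(Q_1,\dots,Q_N)$ (block diagonal), $p=[p_1^T,\dots,p_N^T]^T$, $r=\sum_ir_i$. Network: $W$ is a symmetric doubly stochastic $N\times N$ matrix associated with a connected undirected graph on $\{1,\dots,N\}$ (for $i\neq j$, $W_{ij}>0$ if $(i,j)$ is an edge and $W_{ij}=0$ otherwise; $W_{ii}>0$); $\mathcal W:=W\otimes I_d$. Noise: $w^{(k)}=[(w_1^{(k)})^T,\dots,(w_N^{(k)})^T]^T\in\mathbb{R}^{Nd}$, where the $w_i^{(k)}$ are i.i.d. over all $i$ and $k$ with zero mean and covariance $\frac{\sigma^2}{d}I_d$, $\sigma>0$. $x^{(0)},x^{(-1)}$ are deterministic. $x^\infty$ is the unique solution of $(I_{Nd}-\mathcal W)x^\infty+\alpha\nabla F(x^\infty)=0$. For a random vector $X$, $\mathrm{Var}(X)=\mathbb{E}\|X-\mathbb{E}X\|^2$ (trace of the covariance matrix). *)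

(* Defs.v *)
From HB Require Import structures.
From mathcomp Require Import all_boot all_order all_algebra.
From mathcomp Require Import complex mxtens.
From mathcomp Require Import all_classical all_reals all_analysis.
Set Implicit Arguments.
Unset Strict Implicit.
Unset Printing Implicit Defensive.
Import Order.TTheory GRing.Theory Num.Theory.
Import numFieldNormedType.Exports.
Local Open Scope classical_set_scope.
Local Open Scope ring_scope.

(* R^{Nd} is 'cV[R]_(N * d), with coordinate (i, a) at mxtens_index (i, a),
   i.e. at position i * d + a. This is the ordering under which W *t 1%:M is
   the Kronecker product of W with the identity. *)
Section Blocks.
Context {R : realType} {N d : nat}.

Definition block (i : 'I_N) (x : 'cV[R]_(N * d)) : 'cV[R]_d :=
  \col_a x (mxtens_index (i, a)) 0.

Definition stack (v : 'I_N -> 'cV[R]_d) : 'cV[R]_(N * d) :=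
  \col_k v (mxtens_unindex k).1 (mxtens_unindex k).2 0.

Definition block_diag (Q : 'I_N -> 'M[R]_d) : 'M[R]_(N * d) :=
  \matrix_(k, l)
    if (mxtens_unindex k).1 == (mxtens_unindex l).1
    then Q (mxtens_unindex k).1 (mxtens_unindex k).2 (mxtens_unindex l).2
    else 0.

End Blocks.

Section LinearAlgebra.
Context {R : realType}.

Definition psdmx n (A : 'M[R]_n) : Prop :=
  forall v : 'cV[R]_n, 0 <= (v^T *m A *m v) 0 0.

Definition loewner_le n (A B : 'M[R]_n) : Prop := psdmx (B - A).

Definition spectral_radius n (A : 'M[R]_n) : R :=
  sup [set Normc.normc z | z in
        [set z : R[i] | eigenvalue (map_mx (real_complex R) A) z]].

(* mu lists all the eigenvalues of A, with multiplicity. *)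
Definition eigenvalues_of n (A : 'M[R]_n) (mu : 'I_n -> R) : Prop :=
  char_poly A = \prod_(i < n) ('X - (mu i)%:P).

(* Nonnegativity of the entries, part of double stochasticity, follows from the
   last two clauses; loops of e play no role. *)
Definition gossip_matrix N (e : rel 'I_N) (W : 'M[R]_N) : Prop :=
  [/\ W^T = W,
      forall i, \sum_j W i j = 1,
      forall j, \sum_i W i j = 1,
      forall i, 0 < W i i
    & forall i j, i != j ->
        (e i j -> 0 < W i j) /\ (~~ e i j -> W i j = 0)].

Definition connected_graph N (e : rel 'I_N) : Prop :=
  symmetric e /\ forall i j, connect e i j.

End LinearAlgebra.

Section Objective.
Context {R : realType} {N d : nat}.

Definition quad (Q : 'M[R]_d) (p : 'cV[R]_d) (r : R) (x : 'cV[R]_d) : R :=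
  2^-1 * (x^T *m Q *m x) 0 0 - (p^T *m x) 0 0 + r.

Definition total_cost (f : 'I_N -> 'cV[R]_d -> R) (x : 'cV[R]_(N * d)) : R :=
  \sum_(i < N) f i (block i x).

Definition grad n (F : 'cV[R]_n -> R) (x : 'cV[R]_n) : 'cV[R]_n :=
  \col_k 'D_(delta_mx k 0) F x.

End Objective.

Section Probability.
Context {disp : measure_display} {T : measurableType disp} {R : realType}.
Variable P : probability T R.

Definition borel_cV n : set (set 'cV[R]_n) := <<s [set A | open A] >>.

Definition random_vector n (X : T -> 'cV[R]_n) : Prop :=
  forall B, borel_cV B -> measurable (X @^-1` B).

Definition independent_family (I : eqType) n (X : I -> T -> 'cV[R]_n) : Prop :=
  forall (s : seq I) (B : I -> set 'cV[R]_n),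
    uniq s -> (forall i, borel_cV (B i)) ->
    P (\bigcap_(i in [set` s]) (X i @^-1` B i)) =
    (\prod_(i <- s) P (X i @^-1` B i))%E.

Definition identically_distributed (I : Type) n (X : I -> T -> 'cV[R]_n) :
    Prop :=
  forall i j B, borel_cV B -> P (X i @^-1` B) = P (X j @^-1` B).

(* No integrability hypothesis is needed separately: the library integral is
   the difference of the integrals of the positive and negative parts, with
   oo - oo = -oo, so that the two equations force square-integrability. *)
Definition centered_isotropic n (X : T -> 'cV[R]_n) (v : R) : Prop :=
  (forall a : 'I_n, 'E_P[(fun t => X t a 0)%R] = 0)%E /\
  (forall a b : 'I_n,
     covariance P (fun t => X t a 0) (fun t => X t b 0) =
     (if a == b then v else 0)%:E).

Definition mean n (X : T -> 'cV[R]_n) : 'cV[R]_n :=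
  \col_a fine 'E_P[(fun t => X t a 0)%R]%E.

Definition norm2sq n (x : 'cV[R]_n) : R := \sum_(a < n) x a 0 ^+ 2.

Definition Var n (X : T -> 'cV[R]_n) : \bar R :=
  'E_P[(fun t => norm2sq (X t - mean X))%R]%E.

End Probability.

Section DASG.
Context {R : realType} {N d : nat}.
Variables (W : 'M[R]_N) (F : 'cV[R]_(N * d) -> R) (alpha beta : R).

Definition calW : 'M[R]_(N * d) := W *t (1%:M : 'M[R]_d).

Definition fixed_point_eq (x : 'cV[R]_(N * d)) : Prop :=
  (1%:M - calW) *m x + alpha *: grad F x = 0.

Definition dasg_step (x x' w : 'cV[R]_(N * d)) : 'cV[R]_(N * d) :=
  let y := (1 + beta) *: x - beta *: x' in
  calW *m y - alpha *: (grad F y + w).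

(* The pair (x^(k), x^(k-1)); xm1 is x^(-1), and step k -> k+1 uses w^(k+1). *)
Fixpoint dasg_state (T : Type) (x0 xm1 : 'cV[R]_(N * d))
    (w : nat -> 'I_N -> T -> 'cV[R]_d) (k : nat) (t : T) :
    'cV[R]_(N * d) * 'cV[R]_(N * d) :=
  if k is k'.+1 then
    let s := dasg_state x0 xm1 w k' t in
    (dasg_step s.1 s.2 (stack (fun i => w k i t)), s.1)
  else (x0, xm1).

Definition dasg (T : Type) x0 xm1 (w : nat -> 'I_N -> T -> 'cV[R]_d) k t :
    'cV[R]_(N * d) := (dasg_state x0 xm1 w k t).1.

End DASG.

Definition A_dasg (R : realType) n (M : 'M[R]_n) (beta : R) : 'M[R]_(n + n) :=
  block_mx ((1 + beta) *: M) (- beta *: M) 1%:M 0.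

Definition J_infty disp (T : measurableType disp) (R : realType)
    (P : probability T R) (N n : nat) (sigma : R)
    (x : nat -> T -> 'cV[R]_n) : \bar R :=
  (((sigma ^+ 2 * N%:R)^-1)%:E * limn_esup (fun k => Var P (x k)))%E.

(* Main.v *)
Require Import Defs.
From HB Require Import structures.
From mathcomp Require Import all_boot all_order all_algebra.
From mathcomp Require Import complex mxtens.
From mathcomp Require Import all_classical all_reals all_analysis.
From mathcomp Require Import measurable_realfun ring lra.
Import Order.TTheory GRing.Theory Num.Theory.
Import numFieldNormedType.Exports.
Local Open Scope classical_set_scope.
Local Open Scope ring_scope.

(* The gradient of F is affine, so x^(k) is a deterministic vector minus
   alpha * sum_(j <= k) H_(k-j) w^(j), where H_m = h_m(M) is the impulse response
   of the recursion with M = calW - alpha Q. The noise coordinates being centered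
   and uncorrelated, Var(x^(k)) is alpha^2 sigma^2 / d times the sum over m < k of
   the squared Frobenius norms of H_m; as M is symmetric these are
   sum_i h_m(mu_i)^2. For one eigenvalue, h_m is an AR(2) impulse response whose
   characteristic roots are eigenvalues of A_dasg, so the spectral radius
   hypothesis gives the Jury stability conditions. Under these conditions a
   nonnegative quadratic form V satisfies V(h_m, h_(m-1)) - V(h_(m+1), h_m) = h_m^2,
   and telescoping gives sum_m h_m^2 = V(1, 0), the summand of the theorem. *)

(** * Scalar impulse response *)

(* The pair (h_k, h_(k-1)), with h_(-1) = 0. *)
Fixpoint impulse (F : pzRingType) (b s : F) (k : nat) : F * F :=
  if k is k'.+1 then
    let h := impulse F b s k' in (s * ((1 + b) * h.1 - b * h.2), h.1)
  else (1, 0).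
Arguments impulse {F}.

(** For real roots, [1 - f + q] and [1 + f + q] are the products of [1 - z] and of [1 + z] over the
    roots; for conjugate roots, [q] is the squared modulus. *)
Lemma char_roots_jury (R : rcfType) (f q : R) :
  (forall z : R[i], z ^+ 2 - real_complex R f * z + real_complex R q = 0 ->
     Normc.normc z < 1) ->
  q < 1 /\ `|f| < 1 + q.
Proof.
move=> H.
have [D0|D0] := leP 0 (f ^+ 2 - 4 * q).
  set s := Num.sqrt (f ^+ 2 - 4 * q).
  have s2 : s ^+ 2 = f ^+ 2 - 4 * q by rewrite sqr_sqrtr.
  have H' (t : R) : t ^+ 2 - f * t + q = 0 -> `|t| < 1.
    move=> e; have := H (real_complex R t).
    rewrite -!rmorphXn -!rmorphM -rmorphB -rmorphD e /= => /(_ erefl).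
    by rewrite expr0n /= addr0 sqrtr_sqr.
  have : `|(f + s) / 2| < 1 by apply: H'; nra.
  have : `|(f - s) / 2| < 1 by apply: H'; nra.
  rewrite !ltr_norml => /andP[a1 a2] /andP[b1 b2].
  by split; [nra | apply/andP; split; nra].
set s := Num.sqrt (4 * q - f ^+ 2).
have s2 : s ^+ 2 = 4 * q - f ^+ 2 by rewrite sqr_sqrtr //; lra.
have q0 : 0 < q by nra.
have : Normc.normc (Complex (f / 2) (s / 2)) < 1.
  apply: H; apply/eqP; rewrite expr2 eq_complex /=.
  by apply/andP; split; apply/eqP; lra.
rewrite /= (_ : _ + _ = q); last by lra.
rewrite -[ltRHS]sqrtr1 ltr_sqrt // => q1; split=> //.
(* Here [f ^ 2 < 4 q <= (1 + q) ^ 2]. *)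
rewrite -(@ltr_pXn2r _ 2) ?nnegrE ?real_normK ?num_real//; last by lra.
by have := sqr_ge0 (1 - q); lra.
Qed.

(** With [f = (1 + b) s] and [q = b s] this is [(1 + q) / ((1 - q) ((1 + q) ^ 2 - f ^ 2))], the
    variance of a stable AR(2) process with characteristic polynomial [z ^ 2 - f z + q] and unit
    noise. *)
Definition stationary_energy (R : fieldType) (b s : R) : R :=
  (1 + b * s) / ((1 - s) * (1 - b * s) * (2 + 2 * b - (1 - s) * (1 + 2 * b))).

(* The form V with V(h_k, h_(k-1)) - V(h_(k+1), h_k) = h_k ^ 2. *)
Definition lyapunov (R : fieldType) (b s : R) (h : R * R) : R :=
  stationary_energy R b s *
  (h.1 ^+ 2 - 2 * ((1 + b) * s) * (b * s) / (1 + b * s) * h.1 * h.2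
   + (b * s) ^+ 2 * h.2 ^+ 2).
Arguments stationary_energy {R}.
Arguments lyapunov {R}.

Section Jury.
Context {R : realType} (b s : R).
Hypotheses (q1 : b * s < 1) (fq : `|(1 + b) * s| < 1 + b * s).

Let jury : [/\ 0 < 1 + b * s, 0 < 1 - b * s, 0 < 1 - s &
   0 < 2 + 2 * b - (1 - s) * (1 + 2 * b)].
Proof.
by move: fq; rewrite ltr_norml => /andP[? ?]; split; have := q1; lra.
Qed.

Lemma stationary_energy_gt0 : 0 < stationary_energy b s.
Proof. by have [? ? ? ?] := jury; rewrite divr_gt0 ?mulr_gt0. Qed.

Lemma lyapunov_ge0 h : 0 <= lyapunov b s h.
Proof.
have [c2 c3 c1 c4] := jury.
apply: mulr_ge0; first exact/ltW/stationary_energy_gt0.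
move: fq c2 c3; set f := (1 + b) * s; set q := b * s => fq' c2 c3.
(* Completing the square in [h.1] leaves a coefficient of [h.2 ^ 2] that is nonnegative because
   [|f| < 1 + q]. *)
have -> : h.1 ^+ 2 - 2 * f * q / (1 + q) * h.1 * h.2 + q ^+ 2 * h.2 ^+ 2 =
  (h.1 - f * q / (1 + q) * h.2) ^+ 2 +
  (q * h.2 / (1 + q)) ^+ 2 * ((1 + q) ^+ 2 - f ^+ 2).
  by field; rewrite gt_eqF.
rewrite addr_ge0 ?sqr_ge0// mulr_ge0 ?sqr_ge0//.
by move: fq'; rewrite ltr_norml => /andP[? ?]; nra.
Qed.

Lemma sum_impulse k :
  \sum_(j < k) (impulse b s j).1 ^+ 2 =
  stationary_energy b s - lyapunov b s (impulse b s k).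
Proof.
have [c2 c3 c1 c4] := jury.
elim: k => [|k IH].
  by rewrite big_ord0 /lyapunov /=; ring.
(* The decrement identity holds for an arbitrary pair, so the orbit is forgotten before [field]. *)
rewrite big_ord_recr /= IH /lyapunov /=; move: (impulse b s k) => [a c] /=.
rewrite /stationary_energy; field.
by rewrite !gt_eqF.
Qed.

(** The partial sums increase and, the form being nonnegative, are bounded, so they converge. Hence
    the terms tend to 0, so does the form along the orbit, and this identifies the limit. *)
Lemma cvg_sum_impulse :
  (\sum_(j < k) (impulse b s j).1 ^+ 2) @[k --> \oo] --> stationary_energy b s.
Proof.
pose u : R^nat := fun j => (impulse b s j).1 ^+ 2.
have cu : cvgn (series u).
  apply: nondecreasing_is_cvgn.
    apply/nondecreasing_seqP => n; rewrite /series /= big_nat_recr//= lerDl.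
    exact: sqr_ge0.
  exists (stationary_energy b s) => _ [k _ <-].
  rewrite /series /= big_mkord sum_impulse gerBl; exact: lyapunov_ge0.
have h0 : (impulse b s k).1 @[k --> \oo] --> (0 : R).
  have /cvgr0Pnorm_lt H := cvg_series_cvg_0 cu.
  apply/cvgr0Pnorm_lt => e e0; have := H (e ^+ 2) (exprn_gt0 _ e0).
  apply: filterS => k /=; rewrite /u normrX ltr_pXn2r ?nnegrE//; exact: ltW.
have h1 : (impulse b s k).2 @[k --> \oo] --> (0 : R).
  by rewrite -cvg_shiftS.
have V0 : lyapunov b s (impulse b s k) @[k --> \oo] --> (0 : R).
  rewrite [X in _ --> X](_ : 0 = stationary_energy b s * (0 * 0 -
     2 * ((1 + b) * s) * (b * s) / (1 + b * s) * 0 * 0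
      + (b * s) ^+ 2 * (0 * 0))); last by ring.
  apply: cvgMr; apply: cvgD; last by apply: cvgMr; apply: cvgM.
  by apply: cvgB; [apply: cvgM | apply: cvgM => //; apply: cvgMr].
rewrite (_ : (fun k => _) =
  (fun k => stationary_energy b s - lyapunov b s (impulse b s k))); last first.
  by apply/funext => k; rewrite sum_impulse.
by rewrite -[X in _ --> X]subr0; apply: cvgB => //; exact: cvg_cst.
Qed.
End Jury.

(** * From the spectral radius to the Jury conditions *)

Lemma eigenvalue_A_dasg (F : fieldType) n (M : 'M[F]_n) (b s z : F) :
  eigenvalue M s -> z ^+ 2 - (1 + b) * s * z + b * s = 0 ->
  eigenvalue (block_mx ((1 + b) *: M) (- b *: M) 1%:M 0) z.
Proof.
move=> /eigenvalueP[u uM u0] e; apply/eigenvalueP.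
(* Eigenvectors are row vectors. The first block column forces the coefficient [z - (1 + b) * s];
   the second then amounts to the quadratic equation for [z]. *)
exists (row_mx u ((z - (1 + b) * s) *: u)); last first.
  apply: contraNneq u0 => /eqP; rewrite -row_mx0 => /eqP/eq_row_mx[-> _] //.
rewrite mul_row_block mulmx1 mulmx0 addr0 -!scalemxAr uM !scalerA scale_row_mx.
rewrite -scalerDl scalerA; congr row_mx; congr (_ *: _); first by ring.
by apply/eqP; rewrite -subr_eq0; apply/eqP; rewrite -[RHS]oppr0 -[in RHS]e; ring.
Qed.

(** The point is that the set under the [sup] is bounded: the sum of the moduli of all roots of the
    characteristic polynomial is a bound. *)
Lemma spectral_radius_ge (R : realType) n (A : 'M[R]_n) (z : R[i]) :
  eigenvalue (map_mx (real_complex R) A) z ->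
  Normc.normc z <= spectral_radius A.
Proof.
move=> Az; apply: ub_le_sup; last by exists z.
pose p := char_poly (map_mx (real_complex R) A).
have p0 : p != 0 by rewrite monic_neq0 // char_poly_monic.
have [rs prs] := closed_field_poly_normal p.
exists (\sum_(x <- rs) Normc.normc x) => _ [x /= Ax <-].
have xrs : x \in rs.
  move: Ax; rewrite eigenvalue_root_char -/p prs rootZ ?root_prod_XsubC//.
  by rewrite lead_coef_eq0.
rewrite (big_rem x) //= lerDl sumr_ge0 // => y _.
by case: y => a b /=; exact: sqrtr_ge0.
Qed.

Lemma A_dasg_jury (R : realType) n (M : 'M[R]_n) (b s : R) :
  eigenvalue M s -> spectral_radius (A_dasg M b) < 1 ->
  b * s < 1 /\ `|(1 + b) * s| < 1 + b * s.
Proof.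
move=> Ms rho; apply: char_roots_jury => z ze.
apply: le_lt_trans rho; apply: spectral_radius_ge.
rewrite /A_dasg map_block_mx map_mx1 map_mx0 !map_mxZ.
rewrite rmorphN rmorphD rmorph1.
apply: (@eigenvalue_A_dasg _ _ _ _ (real_complex R s)).
  by rewrite eigenvalue_root_char -map_char_poly fmorph_root -eigenvalue_root_char.
by rewrite -[1]/(real_complex R 1) -rmorphD -!rmorphM.
Qed.

(** * Matrix impulse response *)

(* x^(k) depends on the noise w^(j) through - alpha (transfer b M (k - j)).1. *)
Fixpoint transfer (F : pzRingType) n (b : F) (M : 'M[F]_n) (k : nat) :
    'M[F]_n * 'M[F]_n :=
  if k is k'.+1 then
    let H := transfer F n b M k' in
    (M *m ((1 + b) *: H.1 - b *: H.2), H.1)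
  else (1%:M, 0).
Arguments transfer {F n}.

(** Needed because [M] is diagonalised over [R[i]]. *)
Lemma impulse_map (F K : pzRingType) (f : {rmorphism F -> K}) (b s : F) k :
  (f (impulse b s k).1, f (impulse b s k).2) = impulse (f b) (f s) k.
Proof.
elim: k => [|k /= <-] /=; first by rewrite rmorph0 rmorph1.
by rewrite rmorphM rmorphB !rmorphM rmorphD rmorph1.
Qed.

Lemma transfer_map (F K : pzRingType) (f : {rmorphism F -> K}) n (b : F)
    (M : 'M[F]_n) k :
  (map_mx f (transfer b M k).1, map_mx f (transfer b M k).2) =
  transfer (f b) (map_mx f M) k.
Proof.
elim: k => [|k /= <-] /=; first by rewrite map_mx0 map_mx1.
by rewrite map_mxM map_mxB !map_mxZ rmorphD rmorph1.
Qed.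

(** Conjugation passes through the recursion, which on a diagonal matrix is the scalar one in each
    entry. *)
Lemma transfer_conj_diag (F : fieldType) n (b : F) (P : 'M[F]_n) (D : 'rV[F]_n) k :
  P \in unitmx ->
  let H := transfer b (invmx P *m diag_mx D *m P) k in
  let cd (g : F * F -> F) :=
    invmx P *m diag_mx (\row_i g (impulse b (D 0 i) k)) *m P in
  H.1 = cd fst /\ H.2 = cd snd.
Proof.
move=> Pu; elim: k => [|k [IH1 IH2]].
  rewrite /=; set E := \row_(i < n) (1 : F).
  have -> : E = const_mx 1 by apply/rowP => i; rewrite !mxE.
  set E0 := \row_(i < n) (0 : F).
  have -> : E0 = 0 by apply/rowP => i; rewrite !mxE.
  by rewrite diag_const_mx mulmx1 mulVmx// linear0 mulmx0 mul0mx.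
split; last exact: IH1.
rewrite /= IH1 IH2; set d1 := \row__ _; set d2 := \row__ _.
set e := \row__ _.
have -> : e = \row_i (D 0 i * ((1 + b) *: d1 - b *: d2) 0 i).
  by apply/rowP => i; rewrite !mxE.
have dE : diag_mx ((1 + b) *: d1 - b *: d2) =
    (1 + b) *: diag_mx d1 - b *: diag_mx d2.
  by apply/matrixP => i j; rewrite !mxE mulrnBl !mulrnAr.
rewrite -mulmx_diag dE !mulmxBr !mulmxBl -!scalemxAr -!scalemxAl.
by rewrite -!mulmxA !mulKVmx.
Qed.

(** The responses are polynomials in [M]. Commutation yields their symmetry, since transposition
    reverses the product in the recursion. *)
Lemma transfer_comm (F : comPzRingType) n (b : F) (M : 'M[F]_n) k :
  M *m (transfer b M k).1 = (transfer b M k).1 *m M /\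
  M *m (transfer b M k).2 = (transfer b M k).2 *m M.
Proof.
elim: k => [|k [IH1 IH2]] /=; first by rewrite mulmx1 mul1mx mulmx0 mul0mx.
split=> //; rewrite -mulmxA; congr (_ *m _).
by rewrite mulmxBl mulmxBr -!scalemxAr -!scalemxAl IH1 IH2.
Qed.

Lemma transfer_sym (F : comPzRingType) n (b : F) (M : 'M[F]_n) k :
  M^T = M ->
  ((transfer b M k).1)^T = (transfer b M k).1 /\
  ((transfer b M k).2)^T = (transfer b M k).2.
Proof.
move=> MT; elim: k => [|k [IH1 IH2]] /=; first by rewrite trmx1 trmx0.
split=> //; rewrite trmx_mul MT.
have -> (A B : 'M[F]_n) (c c' : F) :
    (c *: A - c' *: B)^T = c *: A^T - c' *: B^T.
  by apply/matrixP => i j; rewrite !mxE.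
rewrite IH1 IH2; have [c1 c2] := transfer_comm _ _ b M k.
by rewrite mulmxBl mulmxBr -!scalemxAr -!scalemxAl c1 c2.
Qed.

Lemma char_poly_conj_diag (F : fieldType) n (P : 'M[F]_n) (D : 'rV[F]_n) :
  P \in unitmx ->
  char_poly (invmx P *m diag_mx D *m P) = \prod_i ('X - (D 0 i)%:P).
Proof.
move=> Pu; rewrite -[RHS](_ : char_poly (diag_mx D) = _); last first.
  rewrite char_poly_trig ?diag_mx_is_trig//.
  by apply: eq_bigr => i _; rewrite mxE eqxx mulr1n.
rewrite /char_poly /char_poly_mx !map_mxM.
set Q := map_mx polyC P; set Q' := map_mx polyC (invmx P).
have QQ : Q' *m Q = 1%:M by rewrite -map_mxM mulVmx// map_mx1.
(* Writing the scalar matrix as its own conjugate makes the whole characteristic matrix a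
   conjugate. *)
have XE : 'X%:M = Q' *m 'X%:M *m Q by rewrite scalar_mxC -mulmxA QQ mulmx1.
rewrite {1}XE -mulmxBl -mulmxBr !det_mulmx mulrAC -det_mulmx QQ det1.
by rewrite mul1r.
Qed.

(** The squared Frobenius norm of a symmetric matrix is the trace of its square, hence the sum of
    its squared eigenvalues. *)
Lemma sum_sqr_transfer (R : realType) n (b : R) (M : 'M[R]_n) (mu : 'I_n -> R) k :
  M^T = M -> eigenvalues_of M mu ->
  \sum_i \sum_j (transfer b M k).1 i j ^+ 2 =
  \sum_i (impulse b (mu i) k).1 ^+ 2.
Proof.
move=> MT Mmu.
set H := (transfer b M k).1.
have HT : H^T = H by have [] := transfer_sym _ _ b M k MT.
have -> : \sum_i \sum_j H i j ^+ 2 = \tr (H *m H).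
  apply: eq_bigr => i _; rewrite mxE; apply: eq_bigr => j _.
  by rewrite expr2 -{2}HT mxE.
apply: (fmorph_inj (real_complex R)).
set f := real_complex R.
rewrite -trace_map_mx map_mxM.
(* A real symmetric matrix is Hermitian over [R[i]], hence normal and unitarily diagonalisable. *)
have MC : map_mx f M = invmx (spectralmx (map_mx f M)) *m
    diag_mx (spectral_diag (map_mx f M)) *m spectralmx (map_mx f M).
  apply/orthomx_spectralP/hermitian_normalmx/realsym_hermsym.
    apply/is_hermitianmxP.
    by rewrite expr0 scale1r map_mx_id // map_trmx MT.
  by apply/mxOverP => i j; rewrite mxE; apply/complex_realP; exists (M i j).
move: MC; set P := spectralmx _; set D := spectral_diag _ => MC.
have Pu : P \in unitmx by exact: spectral_unit.
have -> : map_mx f H = (transfer (f b) (map_mx f M) k).1 by rewrite -transfer_map.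
rewrite MC; have [-> _] := transfer_conj_diag _ _ (f b) P D k Pu.
set E := diag_mx _.
rewrite !mulmxA mulmxK // mxtrace_mulC !mulmxA mulmxV // mul1mx.
rewrite mulmx_diag mxtrace_diag rmorph_sum /=.
(* [D] and [mu] both list the roots of the characteristic polynomial of [M], so they agree up to
   order. *)
have pe : perm_eq [seq D 0 i | i <- index_enum 'I_n] [seq f (mu i) | i <- index_enum 'I_n].
  apply: prod_XsubC_eq; rewrite !big_map -(char_poly_conj_diag _ _ P)//.
  rewrite -MC -map_char_poly Mmu rmorph_prod; apply: eq_bigr => i _.
  by rewrite /= map_polyXsubC.
under eq_bigr do rewrite !mxE -expr2.
rewrite -(big_map (fun i => D 0 i) xpredT (fun d => (impulse (f b) d k).1 ^+ 2)).
rewrite (perm_big _ pe) big_map; apply: eq_bigr => i _.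
by rewrite -impulse_map /= rmorphXn.
Qed.

(** * Means and independence *)

Section HasMean.
Context {disp : measure_display} {T : measurableType disp} {R : realType}.
Variable P : probability T R.

(** Integrability travels with the value, as linearity of the expectation relies on it. *)
Definition has_mean (X : T -> R) (c : R) : Prop :=
  P.-integrable setT (EFin \o X) /\ ('E_P[X] = c%:E)%E.

Lemma has_mean_cst c : has_mean (fun=> c) c.
Proof.
split; first exact: finite_measure_integrable_cst.
exact: expectation_cst.
Qed.

Lemma has_meanD X Y a b : has_mean X a -> has_mean Y b ->
  has_mean (fun t => X t + Y t) (a + b).
Proof.
move=> [iX eX] [iY eY]; split.
  rewrite (_ : EFin \o _ = (EFin \o X) \+ (EFin \o Y))%E //.
  exact: integrableD.
rewrite (_ : (fun _ => _) = X \+ Y)// expectationD; try exact/Lfun1_integrable.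
by rewrite eX eY.
Qed.

Lemma has_meanZ X a c : has_mean X a -> has_mean (fun t => c * X t) (c * a).
Proof.
move=> [iX eX]; split.
  rewrite (_ : EFin \o _ = fun t => c%:E * (EFin \o X) t)%E //.
  exact: integrableZl.
rewrite (_ : (fun _ => _) = c \o* X); last by apply/funext => t /=; rewrite mulrC.
by rewrite expectationZl ?eX//; exact/Lfun1_integrable.
Qed.

Lemma has_mean_sum (I : Type) (s : seq I) (X : I -> T -> R) (a : I -> R) :
  (forall i, has_mean (X i) (a i)) ->
  has_mean (fun t => \sum_(i <- s) X i t) (\sum_(i <- s) a i).
Proof.
move=> H; elim: s => [|i s IH].
  rewrite (_ : (fun t => _) = fun=> 0) ?big_nil; first exact: has_mean_cst.
  by apply/funext => t; rewrite big_nil.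
rewrite big_cons (_ : (fun t => _) = fun t => X i t + \sum_(i <- s) X i t).
  exact: has_meanD.
by apply/funext => t; rewrite big_cons.
Qed.

(** Mixed products have mean zero, so only the squares survive the expansion. *)
Lemma has_mean_sqr_lin (I : finType) (v : R) (X : I -> T -> R) (g : I -> R) :
  (forall i j, has_mean (fun t => X i t * X j t) (if i == j then v else 0)) ->
  has_mean (fun t => (\sum_i g i * X i t) ^+ 2) (v * \sum_i g i ^+ 2).
Proof.
move=> H.
have := has_mean_sum _ (index_enum I) _ _ (fun i =>
  has_mean_sum _ (index_enum I) _ _ (fun j => has_meanZ _ _ (g i * g j) (H i j))).
congr has_mean.
  apply/funext => t; rewrite expr2 big_distrl /=; apply: eq_bigr => i _.
  by rewrite big_distrr; apply: eq_bigr => j _ /=; ring.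
rewrite big_distrr; apply: eq_bigr => i _ /=.
rewrite (bigD1 i)//= eqxx big1 ?addr0; first by ring.
by move=> j /negPf ji; rewrite eq_sym ji mulr0.
Qed.

Lemma Lfun2_of_mean_sqr (X : T -> R) (v : R) :
  measurable_fun setT X -> ('E_P[(X * X)%R] = v%:E)%E -> X \in Lfun P 2%:E.
Proof.
move=> mX eX; rewrite inE; apply/andP; split; rewrite inE //= /finite_norm.
rewrite unlock /=; apply: poweR_lty.
apply: le_lt_trans (ltry v); rewrite -eX unlock le_eqVlt; apply/orP; left.
apply/eqP; apply: eq_integral => t _.
by rewrite /= powR_mulrn // real_normK ?num_real// expr2.
Qed.

Lemma covariance_centered (X Y : T -> R) :
  ('E_P[X] = 0 -> 'E_P[Y] = 0 -> covariance P X Y = 'E_P[(X * Y)%R])%E.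
Proof.
move=> eX eY; rewrite unlock eX eY /=; congr expectation.
by apply/funext => t; rewrite -[LHS]/((X t - 0) * (Y t - 0)) !subr0.
Qed.

(* The law of (X, Y) is the product of the two laws, so this is Fubini. *)
Lemma has_mean_mul_indep (X Y : T -> R) a b :
  measurable_fun setT X -> measurable_fun setT Y ->
  (forall A B, measurable A -> measurable B ->
    P (X @^-1` A `&` Y @^-1` B) = P (X @^-1` A) * P (Y @^-1` B))%E ->
  has_mean X a -> has_mean Y b ->
  P.-integrable setT (EFin \o (fun t => X t * Y t)) ->
  has_mean (fun t => X t * Y t) (a * b).
Proof.
move=> mX mY ind [iX eX] [iY eY] iXY; split=> //.
have mXY : measurable_fun setT (fun t => (X t, Y t)).
  exact: measurable_fun_pair.
pose X' : {mfun T >-> R} := HB.pack X (isMeasurableFun.Build _ _ _ _ _ mX).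
pose Y' : {mfun T >-> R} := HB.pack Y (isMeasurableFun.Build _ _ _ _ _ mY).
pose Z : {mfun T >-> (R * R)%type} :=
  HB.pack (fun t => (X t, Y t)) (isMeasurableFun.Build _ _ _ _ _ mXY).
pose PX := distribution P X'; pose PY := distribution P Y'.
pose PZ := distribution P Z.
pose f (z : R * R) : \bar R := (z.1 * z.2)%:E.
have mf : measurable_fun setT f.
  by apply/measurable_EFinP; apply: measurable_funM.
(* Independence gives agreement on rectangles, which determine the product measure. *)
have PE C : measurable C -> (PX \x PY)%E C = PZ C.
  apply: product_measure_unique => A B mA mB.
  by rewrite -[RHS]ind.
have ifZ : PZ.-integrable setT f by exact: integrable_pushforward.
have ifXY : (PX \x PY)%E.-integrable setT f.
  apply/integrableP; split=> //; have /integrableP[_ ?] := ifZ.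
  by rewrite (eq_measure_integral PZ)// => C mC _; exact: PE.
have mid : measurable_fun setT (EFin : R -> \bar R) by exact/measurable_EFinP.
have iPX : PX.-integrable setT EFin by exact: integrable_pushforward.
have iPY : PY.-integrable setT EFin by exact: integrable_pushforward.
have EX : (\int[PX]_x x%:E = a%:E)%E.
  by rewrite -eX unlock -(@integral_distribution _ _ _ _ _ P X' EFin mid iX).
have EY : (\int[PY]_x x%:E = b%:E)%E.
  by rewrite -eY unlock -(@integral_distribution _ _ _ _ _ P Y' EFin mid iY).
rewrite unlock -[LHS](@integral_distribution _ _ _ _ _ P Z f mf iXY).
rewrite (eq_measure_integral (PX \x PY)%E); last first.
  by move=> C mC _; exact/esym/PE.
rewrite -integral12_prod_meas1 // /fubini_F.
transitivity (\int[PX]_x (b%:E * x%:E))%E.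
  apply: eq_integral => x _; rewrite muleC -EY -integralZl//.
by rewrite integralZl// EX -EFinM mulrC.
Qed.

(** Coordinates are continuous, so preimages of open intervals, which generate the Borel sets of the
    line, are open. *)
Lemma borel_cV_coord n (a : 'I_n) (B : set R) :
  measurable B -> borel_cV ((fun v : 'cV[R]_n => v a 0) @^-1` B).
Proof.
move=> mB.
have : measurable_fun setT
    (fun v : g_sigma_algebraType [set A : set 'cV[R]_n | open A] => v a 0 : R).
  apply: (measurability _ (RGenOpens.measurableE R)).
  move=> _ [_ [x [y ->] <-]]; rewrite setTI; apply: sub_sigma_algebra => /=.
  have /continuousP := @coord_continuous R n 1 a 0; apply.
  exact: interval_open.
by move=> /(_ measurableT B mB); rewrite setTI.
Qed.

Lemma random_vector_coord n (X : T -> 'cV[R]_n) (a : 'I_n) :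
  random_vector X -> measurable_fun setT (fun t => X t a 0).
Proof.
move=> mX _ B mB; rewrite setTI.
exact: mX ((fun v : 'cV[R]_n => v a 0) @^-1` B) (borel_cV_coord _ a _ mB).
Qed.

Lemma independent_family_coord (I : eqType) n (X : I -> T -> 'cV[R]_n)
    (i j : I) (a b : 'I_n) (A B : set R) :
  independent_family P X -> i != j -> measurable A -> measurable B ->
  let Xa t := X i t a 0 in let Xb t := X j t b 0 in
  (P (Xa @^-1` A `&` Xb @^-1` B) = P (Xa @^-1` A) * P (Xb @^-1` B))%E.
Proof.
move=> ind ij mA mB Xa Xb.
have ji : j == i = false by rewrite eq_sym; apply/negbTE.
have := ind [:: i; j] (fun k => if k == i
  then (fun v : 'cV[R]_n => v a 0) @^-1` A
  else (fun v : 'cV[R]_n => v b 0) @^-1` B).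
rewrite /= inE ij => /(_ erefl) H.
have {}H := H (fun k => ltac:(by case: ifP => _; exact: borel_cV_coord)).
rewrite big_cons big_seq1 eqxx ji in H; rewrite -[RHS]H; congr (P _).
apply/seteqP; split => t /=.
  by move=> [tA tB] k; rewrite /= !inE => /orP[]/eqP->; rewrite ?eqxx ?ji.
by move=> H'; split; [have := H' i|have := H' j];
  rewrite /= !inE eqxx ?orbT ?ji; apply.
Qed.

(** * Second moments of the noise coordinates *)

Section Noise.
Context {N d : nat} (w : nat -> 'I_N -> T -> 'cV[R]_d) (v : R).
Hypotheses (mw : forall k i, random_vector (w k.+1 i))
  (indw : independent_family P (fun ki : nat * 'I_N => w ki.1.+1 ki.2))
  (covw : forall k i, centered_isotropic P (w k.+1 i) v).

Definition noise (j : nat) (l : 'I_(N * d)) (t : T) : R :=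
  stack (fun i => w j.+1 i t) l 0.

Let noiseE j l :
  noise j l = fun t => w j.+1 (mxtens_unindex l).1 t (mxtens_unindex l).2 0.
Proof. by apply/funext => t; rewrite /noise mxE. Qed.

Let Lfun2_noise j l : noise j l \in Lfun P 2%:E.
Proof.
rewrite noiseE; have [m0 cov] := covw j (mxtens_unindex l).1.
apply: (Lfun2_of_mean_sqr _ v); first exact/random_vector_coord/mw.
by rewrite -covariance_centered ?m0// cov eqxx.
Qed.

Lemma has_mean_noise j l : has_mean (noise j l) 0.
Proof.
split.
  apply/Lfun1_integrable; apply: Lfun_subset12 (Lfun2_noise j l).
  by rewrite fin_num_measure.
by rewrite noiseE; have [m0 _] := covw j (mxtens_unindex l).1.
Qed.

Lemma has_mean_noise_mul j l j' l' :
  has_mean (fun t => noise j l t * noise j' l' t)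
    (if (j, l) == (j', l') then v else 0).
Proof.
have iM : P.-integrable setT (EFin \o (fun t => noise j l t * noise j' l' t)).
  by apply/Lfun1_integrable; exact: Lfun2_mul_Lfun1.
set i := (mxtens_unindex l).1; set i' := (mxtens_unindex l').1.
(* Independence covers distinct pairs of time and agent. Coordinates of one and the same noise
   vector are only known to be uncorrelated, so that case uses the covariance. *)
have [e|ne] := eqVneq (j, i) (j', i'); last first.
  rewrite ifN; last by apply: contra_neq ne => -[-> ll]; rewrite /i ll.
  rewrite -[X in has_mean _ X](mulr0 0).
  apply: has_mean_mul_indep => //; try exact: has_mean_noise.
  - by rewrite noiseE; exact/random_vector_coord/mw.
  - by rewrite noiseE; exact/random_vector_coord/mw.
  - move=> A B mA mB; rewrite !noiseE.
    exact: (independent_family_coord _ _ _ (j, i) (j', i') _ _ A B indw ne mA mB).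
split=> //; have ej : j = j' := congr1 fst e; have ei : i = i' := congr1 snd e.
have [m0 cov] := covw j i; have := cov (mxtens_unindex l).2 (mxtens_unindex l').2.
rewrite covariance_centered// => ec.
have -> : ((j, l) == (j', l')) = ((mxtens_unindex l).2 == (mxtens_unindex l').2).
  rewrite xpair_eqE ej eqxx andTb; apply/eqP/eqP => [->//|e2].
  apply: (can_inj (@mxtens_unindexK _ _)).
  by rewrite [LHS]surjective_pairing [RHS]surjective_pairing e2 -/i -/i' ei.
by rewrite -ec; congr expectation; apply/funext => t; rewrite !noiseE -ej -/i' -ei.
Qed.

End Noise.

End HasMean.

(** * The quadratic objective *)

(** For [h != 0] the difference quotient is exactly [c + h * e]. *)
Lemma derive_quadratic (R : realType) n (f : 'cV[R]_n -> R) (x v : 'cV[R]_n) c e :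
  (forall h, f (h *: v + x) = f x + h * c + h ^+ 2 * e) -> 'D_v f x = c.
Proof.
move=> H; apply: cvg_lim => //.
have : (c + h * e) @[h --> 0^'] --> c.
  rewrite -[X in _ --> X]addr0 -[X in _ --> _ + X](mul0r e).
  apply: cvgD; first exact: cvg_cst.
  by apply: cvgMl; apply: nbhs_dnbhs.
apply: cvg_trans; apply: near_eq_cvg; near=> h.
have h0 : h != 0 by near: h; exact: nbhs_dnbhs_neq.
rewrite /= H -[RHS]/(h^-1 * (f x + h * c + h ^+ 2 * e - f x)).
by field.
Unshelve. all: by end_near.
Qed.

Lemma quad_shift (R : realType) d (Q : 'M[R]_d) (p : 'cV[R]_d) r (x v : 'cV[R]_d) h :
  Q^T = Q ->
  quad Q p r (h *: v + x) = quad Q p r x +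
    h * ((v^T *m Q *m x) 0 0 - (p^T *m v) 0 0) + h ^+ 2 * (2^-1 * (v^T *m Q *m v) 0 0).
Proof.
move=> QT; rewrite /quad.
have -> : (h *: v + x)^T = h *: v^T + x^T by apply/matrixP => i j; rewrite !mxE.
rewrite !mulmxDl !mulmxDr -!scalemxAl -!scalemxAr.
(* A 1 by 1 matrix equals its transpose; as [Q] is symmetric, the two cross terms merge. *)
have -> : x^T *m Q *m v = v^T *m Q *m x.
  have tr1 (A : 'M[R]_1) : A^T = A by apply/matrixP => i j; rewrite mxE !ord1.
  by rewrite -[LHS]tr1 !trmx_mul trmxK QT mulmxA.
by rewrite !mxE; field.
Qed.

(** Along the basis direction of coordinate [(i, a)] only block [i] moves, so a single summand of
    the cost contributes. *)
Lemma grad_total_cost (R : realType) N d (Q : 'I_N -> 'M[R]_d)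
    (p : 'I_N -> 'cV[R]_d) (r : 'I_N -> R) (x : 'cV[R]_(N * d)) :
  (forall i, (Q i)^T = Q i) ->
  grad (total_cost (fun i => quad (Q i) (p i) (r i))) x =
  block_diag Q *m x - stack p.
Proof.
move=> QT; apply/colP => k; case: (mxtens_indexP k) => i a {k}; rewrite mxE.
set v := delta_mx _ 0.
have bD h j : block j (h *: v + x) = h *: block j v + block j x.
  by apply/colP => b; rewrite !mxE.
set c := fun j => ((block j v)^T *m Q j *m block j x) 0 0 - ((p j)^T *m block j v) 0 0.
rewrite (@derive_quadratic _ _ _ _ _ (\sum_i c i)
  (\sum_i 2^-1 * ((block i v)^T *m Q i *m block i v) 0 0)); last first.
  move=> h; rewrite /total_cost !big_distrr -!big_split /=.
  by apply: eq_bigr => j _; rewrite bD quad_shift.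
rewrite /c /v => {bD c v}.
have bv j : block j (delta_mx (mxtens_index (i, a)) 0) =
    if j == i then delta_mx a 0 else 0 :> 'cV[R]_d.
  apply/colP => b; rewrite !mxE (can_eq (@mxtens_indexK _ _)) xpair_eqE andbT.
  by case: eqP => _; rewrite !mxE ?andbT.
rewrite (bigD1 i) //= bv eqxx big1 ?addr0; last first.
  move=> j /negPf ji; rewrite bv ji mulmx0 trmx0 !mul0mx !mxE subr0 //.
rewrite trmx_delta -mulmxA -rowE -colE !mxE mxtens_indexK /=; congr (_ - _).
rewrite (reindex (@mxtens_index N d)) /=; last first.
  by exists (@mxtens_unindex N d) => ? _; rewrite ?mxtens_indexK ?mxtens_unindexK.
transitivity (\sum_j \sum_b block_diag Q (mxtens_index (i, a))
  (mxtens_index (j, b)) * x (mxtens_index (j, b)) 0); last first.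
  by rewrite pair_bigA; apply: eq_bigr => -[].
rewrite (bigD1 i) //= [X in _ + X]big1 ?addr0.
  by apply: eq_bigr => b _; rewrite !mxE !mxtens_indexK /= eqxx.
move=> j ji; apply: big1 => b _.
by rewrite !mxE !mxtens_indexK /= eq_sym (negPf ji) mul0r.
Qed.

Lemma dasg_matrix_sym (R : realType) N d (Q : 'I_N -> 'M[R]_d) (W : 'M[R]_N) alpha :
  (forall i, (Q i)^T = Q i) -> W^T = W ->
  (calW W - alpha *: block_diag Q : 'M[R]_(N * d))^T = calW W - alpha *: block_diag Q.
Proof.
move=> QT WT; have cWT : (calW W : 'M[R]_(N * d))^T = calW W.
  by rewrite /calW trmx_tens WT trmx1.
have BT : (block_diag Q)^T = block_diag Q.
  apply/matrixP => k l; rewrite !mxE eq_sym; case: eqP => // <-.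
  by rewrite -[in LHS]QT mxE.
by rewrite -[in RHS]cWT -[in RHS]BT; apply/matrixP => k l; rewrite !mxE.
Qed.

(** * Variance of the iterates *)

(** [c] is chosen before [t], hence deterministic; it absorbs the starting points and [q]. Both
    components are carried because the recursion has order two. *)
Lemma dasg_state_unroll (R : realType) N d (T : Type) (W : 'M[R]_N)
    (F : 'cV[R]_(N * d) -> R) (B : 'M[R]_(N * d)) (q : 'cV[R]_(N * d))
    alpha beta x0 xm1 (w : nat -> 'I_N -> T -> 'cV[R]_d)
    (M := calW W - alpha *: B) k :
  (forall x, grad F x = B *m x - q) ->
  exists c : 'cV[R]_(N * d) * 'cV[R]_(N * d), forall t,
    let s := dasg_state W F alpha beta x0 xm1 w k t in
    let n j : 'cV[R]_(N * d) := stack (fun i => w j.+1 i t) in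
    let H j := transfer beta M (k - j.+1) in
    s.1 = c.1 - alpha *: \sum_(j < k) (H j).1 *m n j /\
    s.2 = c.2 - alpha *: \sum_(j < k) (H j).2 *m n j.
Proof.
move=> gF; elim: k => [|k [c IH]].
  by exists (x0, xm1) => t /=; rewrite !big_ord0 scaler0 !subr0.
exists (M *m ((1 + beta) *: c.1 - beta *: c.2) + alpha *: q, c.1) => t /=.
have [IH1 IH2] := IH t; split; last first.
  (* The newest noise has not reached the previous iterate: its coefficient is the second component
     of [transfer] at 0, which is 0. *)
  rewrite IH1 big_ord_recr /= subnn mul0mx addr0; congr (_ - _ *: _).
  by apply: eq_bigr => j _; rewrite subSS -(subnSK (ltn_ord j)).
set s := dasg_state _ _ _ _ _ _ _ _ _ in IH1 IH2 *; set n := stack _.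
set y := (1 + beta) *: s.1 - beta *: s.2.
have -> : dasg_step W F alpha beta s.1 s.2 n =
    M *m y + alpha *: q - alpha *: n.
  rewrite /dasg_step gF -/y /M mulmxBl -scalemxAl !scalerDr scalerN !opprD opprK.
  by rewrite !addrA.
rewrite big_ord_recr /= subnn mul1mx.
have -> : y = ((1 + beta) *: c.1 - beta *: c.2) - alpha *: \sum_(j < k)
   ((1 + beta) *: (transfer beta M (k - j.+1)).1 -
    beta *: (transfer beta M (k - j.+1)).2) *m stack (fun i => w j.+1 i t).
  rewrite /y IH1 IH2; under [in RHS]eq_bigr do rewrite mulmxBl -!scalemxAl.
  rewrite sumrB -!scaler_sumr; set s1 := \sum_(j < k) _; set s2 := \sum_(j < k) _.
  by apply/colP => a; rewrite !mxE; ring.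
rewrite mulmxBr -scalemxAr mulmx_sumr scalerDr opprD addrA; congr (_ - _).
rewrite addrAC; congr (_ - _ *: _); apply: eq_bigr => j _.
by rewrite mulmxA subSS -(subnSK (ltn_ord j)).
Qed.

Section Variance.
Context {disp : measure_display} {T : measurableType disp} {R : realType}.
Variable P : probability T R.

Lemma Var_affine n (I : finType) (v : R) (xi : I -> T -> R) (g : I -> 'cV[R]_n)
    (c : 'cV[R]_n) (X : T -> 'cV[R]_n) :
  (forall i, has_mean P (xi i) 0) ->
  (forall i j, has_mean P (fun t => xi i t * xi j t) (if i == j then v else 0)) ->
  (forall t, X t = c + \sum_i xi i t *: g i) ->
  Var P X = (v * \sum_a \sum_i g i a 0 ^+ 2)%:E.
Proof.
move=> m1 m2 XE.
have XaE a t : X t a 0 = c a 0 + \sum_i g i a 0 * xi i t.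
  by rewrite XE mxE summxE; congr (_ + _); apply: eq_bigr => i _; rewrite mxE mulrC.
have meanX : mean P X = c.
  apply/colP => a; rewrite mxE.
  have [_] : has_mean P (fun t => X t a 0) (c a 0 + \sum_i g i a 0 * 0).
    rewrite (_ : (fun t => _) = fun t => c a 0 + \sum_i g i a 0 * xi i t).
      apply: has_meanD; first exact: has_mean_cst.
      by apply: has_mean_sum => i; exact: has_meanZ.
    by apply/funext => t; rewrite XaE.
  by move=> ->; rewrite /= big1 ?addr0// => i _; rewrite mulr0.
have [_ <-] : has_mean P (fun t => norm2sq (X t - mean P X))
    (v * \sum_a \sum_i g i a 0 ^+ 2) => //.
rewrite big_distrr /= meanX.
rewrite (_ : (fun t => _) = fun t => \sum_a (\sum_i g i a 0 * xi i t) ^+ 2).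
  by apply: has_mean_sum => a; exact: has_mean_sqr_lin.
apply/funext => t; apply: eq_bigr => a _; rewrite mxE XaE.
by rewrite mxE addrAC subrr add0r.
Qed.

Section Iterates.
Context {N d : nat} (W : 'M[R]_N) (F : 'cV[R]_(N * d) -> R)
  (B : 'M[R]_(N * d)) (q : 'cV[R]_(N * d)) (alpha beta v : R)
  (w : nat -> 'I_N -> T -> 'cV[R]_d) (x0 xm1 : 'cV[R]_(N * d))
  (mu : 'I_(N * d) -> R).
Let M := calW W - alpha *: B.
Hypotheses (gradF : forall x, grad F x = B *m x - q)
  (Msym : M^T = M) (Mmu : eigenvalues_of M mu)
  (mw : forall k i, random_vector (w k.+1 i))
  (indw : independent_family P (fun ki : nat * 'I_N => w ki.1.+1 ki.2))
  (covw : forall k i, centered_isotropic P (w k.+1 i) v).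

Lemma Var_dasg z k :
  Var P (fun t => dasg W F alpha beta x0 xm1 w k t - z) =
  (v * (alpha ^+ 2 * \sum_i \sum_(j < k) (impulse beta (mu i) j).1 ^+ 2))%:E.
Proof.
have [c cE] := dasg_state_unroll R N d T W F B q alpha beta x0 xm1 w k gradF.
(* Matrix-vector products are expanded by columns: coordinate [l] of [noise] at [j] multiplies
   column [l] of the response at lag [k - j - 1]. *)
rewrite (Var_affine _ ('I_k * 'I_(N * d))%type v
  (fun jl => noise w jl.1 jl.2)
  (fun jl => - alpha *: col jl.2 (transfer beta M (k - jl.1.+1)).1) (c.1 - z)).
- congr (v * _)%:E.
  transitivity (\sum_(j < k) \sum_l \sum_a
    (- alpha *: col l (transfer beta M (k - j.+1)).1) a 0 ^+ 2).
    by rewrite exchange_big [RHS]pair_bigA; apply: eq_bigr => -[].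
  (* Time reversal exchanges [j] with the lag [k - j - 1]. *)
  symmetry; rewrite exchange_big (reindex_inj rev_ord_inj) big_distrr; symmetry.
  apply: eq_bigr => j _; rewrite -(sum_sqr_transfer _ _ _ M)// exchange_big /=.
  rewrite big_distrr; apply: eq_bigr => a _; rewrite big_distrr /=.
  by apply: eq_bigr => l _; rewrite !mxE exprMn sqrrN.
- by move=> jl; exact: (has_mean_noise _ _ v).
- move=> [j l] [j' l'] /=.
  have := has_mean_noise_mul P w v mw indw covw j l j' l'.
  by rewrite !xpair_eqE.
move=> t; have [sE _] := cE t; rewrite /dasg sE.
rewrite addrAC; congr (_ + _); rewrite -scaleNr scaler_sumr.
transitivity (\sum_(j < k) \sum_l noise w j l t *:
  (- alpha *: col l (transfer beta M (k - j.+1)).1)); last by rewrite pair_bigA.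
apply: eq_bigr => j _; apply/colP => a; rewrite !mxE summxE big_distrr /=.
by apply: eq_bigr => l _; rewrite !mxE /noise !mxE; ring.
Qed.

Hypothesis rho : spectral_radius (A_dasg M beta) < 1.

Lemma cvg_Var_dasg z :
  Var P (fun t => dasg W F alpha beta x0 xm1 w k t - z) @[k --> \oo] -->
  (v * (alpha ^+ 2 * \sum_i stationary_energy beta (mu i)))%:E.
Proof.
under eq_cvg do rewrite Var_dasg.
apply: cvg_EFin; first by near=> k.
apply: cvgMr; apply: cvgMr; apply: cvg_big => [|i _]; first exact: add_continuous.
have Mi : eigenvalue M (mu i).
  rewrite eigenvalue_root_char Mmu /root horner_prod (bigD1 i) //=.
  by rewrite hornerXsubC subrr mul0r.
have [q1 fq] := A_dasg_jury _ _ _ _ _ Mi rho.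
exact: cvg_sum_impulse.
Unshelve. all: by end_near.
Qed.

End Iterates.
End Variance.
Theorem theorem38
  (R : realType) (disp : measure_display) (T : measurableType disp)
  (P : probability T R)
  (N d : nat) (hN : (0 < N)%N) (hd : (0 < d)%N)
  (m L : R) (hm : 0 < m) (hmL : m <= L)
  (Q : 'I_N -> 'M[R]_d) (p : 'I_N -> 'cV[R]_d) (r : 'I_N -> R)
  (hQsym : forall i, (Q i)^T = Q i)
  (hQm : forall i, loewner_le m%:M (Q i))
  (hQL : forall i, loewner_le (Q i) L%:M)
  (e : rel 'I_N) (he : connected_graph e)
  (W : 'M[R]_N) (hW : gossip_matrix e W)
  (alpha beta sigma : R)
  (halpha : 0 < alpha) (hbeta : 0 <= beta) (hsigma : 0 < sigma)
  (w : nat -> 'I_N -> T -> 'cV[R]_d)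
  (hwmeas : forall k i, random_vector (w k.+1 i))
  (hwindep : independent_family P
     (fun ki : nat * 'I_N => w ki.1.+1 ki.2))
  (hwid : identically_distributed P
     (fun ki : nat * 'I_N => w ki.1.+1 ki.2))
  (hwcov : forall k i, centered_isotropic P (w k.+1 i) (sigma ^+ 2 / d%:R))
  (x0 xm1 xinf : 'cV[R]_(N * d))
  (mu : 'I_(N * d) -> R)
  (F := total_cost (fun i => quad (Q i) (p i) (r i)))
  (M := calW W - alpha *: block_diag Q)
  (x := dasg W F alpha beta x0 xm1 w)
  (S := \sum_(i < N * d)
     alpha ^+ 2 * (1 + beta * mu i) /
     ((1 - mu i) * (1 - beta * mu i) *
      (2 + 2 * beta - (1 - mu i) * (1 + 2 * beta))))
  (hxinf : fixed_point_eq W F alpha xinf)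
  (hmu : eigenvalues_of M mu)
  (hrho : spectral_radius (A_dasg M beta) < 1) :
  (Var P (fun t => x k t - xinf) @[k --> \oo] --> (sigma ^+ 2 / d%:R * S)%:E)
  /\ J_infty P N sigma x = ((N%:R * d%:R)^-1 * S)%:E.
Proof.
have QE := grad_total_cost R N d Q p r ^~ hQsym.
have [WT _ _ _ _] := hW.
have SE : S = alpha ^+ 2 * \sum_i stationary_energy beta (mu i).
  by rewrite big_distrr; apply: eq_bigr => i _; rewrite /= mulrA.
(* A deterministic shift does not affect the variance: [z = xinf] gives the first claim and [z = 0]
   the second. *)
have lim z : Var P (fun t => x k t - z) @[k --> \oo] -->
    (sigma ^+ 2 / d%:R * S)%:E.
  rewrite SE; apply: (cvg_Var_dasg _ _ _ _ _ _ _ _ _ _ _ _ QE) => //.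
  exact: dasg_matrix_sym.
split; first exact: lim.
have x_lim : Var P (x k) @[k --> \oo] --> (sigma ^+ 2 / d%:R * S)%:E.
  rewrite (_ : (fun k => _) = fun k => Var P (fun t => x k t - 0)).
    exact: lim.
  by apply/funext => k; congr Var; apply/funext => t; rewrite subr0.
(* By convergence the upper limit is the limit; then [sigma ^ 2] cancels. *)
rewrite /J_infty (cvg_limn_einf_sup x_lim).2 -EFinM; congr (_%:E).
by field; rewrite !pnatr_eq0 -!lt0n hN hd gt_eqF.
Qed.
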